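(* Let $S_1$ and $S_2$ be two isometries such that $S_1S_1^*+S_2S_2^*=1$, and let $\sigma$ be the unique order two automorphism of $\mathcal{O}_2=C^*(S_1,S_2)$ such that $\sigma(S_1)=S_2$. Then $\sigma$ is not inner, i.e. there is no unitary $u\in\mathcal{O}_2$ such that $\sigma(a)=uau^*$ for all $a\in\mathcal{O}_2$.
   Context: The Cuntz algebra $\mathcal{O}_2$ is the universal unital C*-algebra generated by two isometries $S_1,S_2$ with $S_1S_1^*+S_2S_2^*=1$. It is simple, and for any two isometries satisfying this relation on a nonzero Hilbert space, the C*-algebra $C^*(S_1,S_2)$ they generate is (canonically) $\mathcal{O}_2$. By universality there is a unique *-automorphism $\sigma$ of $\mathcal{O}_2$ with $\sigma(S_1)=S_2$ and $\sigma(S_2)=S_1$; it satisfies $\sigma^2=\mathrm{id}$. *)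

(* Defs.v *)
From HB Require Import structures.
From mathcomp Require Import all_boot all_order all_algebra.
From mathcomp Require Import all_classical all_reals all_analysis.
From mathcomp Require Export complex.

Set Implicit Arguments.
Unset Strict Implicit.
Unset Printing Implicit Defensive.

Import Order.TTheory GRing.Theory Num.Theory.
Import numFieldNormedType.Exports.

Local Open Scope classical_set_scope.
Local Open Scope ring_scope.

(* The unital ring structure is given by raw operations on top of a complex
   Banach space, because the hierarchy of MathComp has no common substructure
   of rings and normed modules from which numDomainType inherits, so that the
   two cannot be joined; the algType structure is installed right below.
   The norm of a normed R[i]-module is R[i]-valued (and hence a nonnegative
   real), and Num.conj is complex conjugation. *)
HB.mixin Record isCStarAlgebra (R : realType) A
    of CompleteNormedModule R[i] A := {
  cmul : A -> A -> A ;
  cone : A ;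
  cmulA : associative cmul ;
  cmul1l : left_id cone cmul ;
  cmul1r : right_id cone cmul ;
  cmulDl : left_distributive cmul +%R ;
  cmulDr : right_distributive cmul +%R ;
  cone_neq0 : cone != 0 ;
  cscalerAl : forall (k : R[i]) (a b : A), k *: cmul a b = cmul (k *: a) b ;
  cscalerAr : forall (k : R[i]) (a b : A), k *: cmul a b = cmul a (k *: b) ;
  star : A -> A ;
  starK : involutive star ;
  starD : forall a b : A, star (a + b) = star a + star b ;
  starZ : forall (k : R[i]) (a : A), star (k *: a) = Num.conj k *: star a ;
  starM : forall a b : A, star (cmul a b) = cmul (star b) (star a) ;
  cnormM : forall a b : A, `|cmul a b| <= `|a| * `|b| ;
  cnorm_star : forall a : A, `|cmul (star a) a| = `|a| ^+ 2
}.

(* Unital, nonzero complex C*-algebras. *)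
#[short(type="cstarAlgType")]
HB.structure Definition CStarAlgebra (R : realType) :=
  {A of CompleteNormedModule R[i] A & isCStarAlgebra R A}.

Section CStarIsAlgebra.
Context (R : realType) (A : cstarAlgType R).

#[non_forgetful_inheritance]
HB.instance Definition _ := GRing.Zmodule_isNzRing.Build (CStarAlgebra.sort A)
  (@cmulA R A) (@cmul1l R A) (@cmul1r R A) (@cmulDl R A) (@cmulDr R A)
  (@cone_neq0 R A).

#[non_forgetful_inheritance]
HB.instance Definition _ :=
  GRing.Lmodule_isLalgebra.Build R[i] (CStarAlgebra.sort A) (@cscalerAl R A).

#[non_forgetful_inheritance]
HB.instance Definition _ :=
  GRing.Lalgebra_isAlgebra.Build R[i] (CStarAlgebra.sort A) (@cscalerAr R A).

End CStarIsAlgebra.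

Section CStar.
Context {R : realType} {A : cstarAlgType R}.
Implicit Types (D : set A) (a b u s : A) (f : A -> A).

Definition isometry_elt s := star s * s = 1.

Definition unitary_elt u := star u * u = 1 /\ u * star u = 1.

Definition cstar_subalgebra D :=
  [/\ closed D, D 1,
      (forall (k : R[i]) a b, D a -> D b -> D (k *: a + b)),
      (forall a b, D a -> D b -> D (a * b))
    & (forall a, D a -> D (star a))].

Definition cstar_gen (G : set A) : set A := smallest cstar_subalgebra G.

(* A self-map of a subalgebra D is represented by a map on the ambient algebra,
   whose values outside D are irrelevant. *)
Definition star_automorphism D f :=
  [/\ set_bij D D f,
      (forall (k : R[i]) a b, D a -> D b -> f (k *: a + b) = k *: f a + f b),
      (forall a b, D a -> D b -> f (a * b) = f a * f b)
    & (forall a, D a -> f (star a) = star (f a))].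

Definition order_two_on D f :=
  (forall a, D a -> f (f a) = a) /\ (exists2 a, D a & f a <> a).

Definition inner_on D f :=
  exists u, [/\ D u, unitary_elt u & forall a, D a -> f a = u * a * star u].

End CStar.

(* Main.v *)
Require Import Defs.
From mathcomp Require Import all_boot all_order all_algebra.
From mathcomp Require Import all_classical all_reals all_analysis.
Import GRing.Theory Num.Theory.
Local Open Scope classical_set_scope.
Local Open Scope ring_scope.

Import Order.TTheory.

Set Implicit Arguments.
Unset Strict Implicit.
Unset Printing Implicit Defensive.

(** A unitary u of C*(S1, S2), the C*-algebra generated by S1 and S2, that
    implements sigma satisfies u S1 = S2 u.  Write T for the adjoint of S2.  Then
    u S1^n = S2^n u, hence T^n u S1^n = u for every n: all the compressions
    a |-> T^n a S1^n fix u.  They are contractions, and they eventually kill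
    every *-polynomial a in S1 and S2.  Indeed S1^n absorbs, for n large, all
    the adjoints in a, so that a S1^n becomes a combination of words in S1 and
    S2 without adjoints [absorbed_starS1, absorbed_starS2]; and if w is such a
    word, then T^m w S1^m = 0 for m large, since T^m w is either 0 or a power
    of T, and T S1 = 0 [analytic_vanish].  As the *-polynomials are dense in
    C*(S1, S2) [cstar_gen_closure], u is the limit of elements that the
    compressions kill, so u = 0, which is absurd. *)

(** * Norm and involution *)

Section CStarTheory.
Context {R : realType} {A : cstarAlgType R}.
Implicit Types (a b x : A) (D : set A).

Lemma star_mul a b : star (a * b) = star b * star a.
Proof. exact: starM. Qed.

Lemma norm_mul_le a b : `|a * b| <= `|a| * `|b|.
Proof. exact: cnormM. Qed.

Lemma norm_star_mul a : `|star a * a| = `|a| ^+ 2.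
Proof. exact: cnorm_star. Qed.

Lemma star1 : star 1 = 1 :> A.
Proof. by rewrite -[LHS]mulr1 -[X in _ * X]starK -star_mul mulr1 starK. Qed.

Lemma star_sub a b : star (a - b) = star a - star b.
Proof. by rewrite -scaleN1r starD starZ rmorphN1 scaleN1r. Qed.

Lemma star0 : star 0 = 0 :> A.
Proof. by apply: (addIr (star 0)); rewrite -starD !add0r. Qed.

Lemma star_mul_eq0 a : star a * a = 0 -> a = 0.
Proof.
move=> a0; apply/normr0_eq0/eqP.
by rewrite -sqrf_eq0 -norm_star_mul a0 normr0.
Qed.

(** The C*-identity and submultiplicativity give |b|^2 <= |star b| |b|, for
    b = a and for b = star a. *)
Lemma norm_star a : `|star a| = `|a|.
Proof.
have le_star b : `|b| <= `|star b|.
  have [->|b0] := eqVneq b 0; first by rewrite normr0.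
  have nb : 0 < `|b| by rewrite normr_gt0.
  by rewrite -(ler_pM2r nb) -expr2 -norm_star_mul norm_mul_le.
by apply: le_anti; rewrite le_star -{2}[a]starK le_star.
Qed.

Lemma norm_isometry a : isometry_elt a -> `|a| = 1.
Proof.
have norm1 : `|1 : A| = 1.
  have n0 : `|1 : A| != 0 by rewrite normr_eq0 oner_eq0.
  apply: (mulfI n0); rewrite mulr1 -expr2 -norm_star_mul star1 mulr1.
  by [].
move=> aK; apply/eqP; rewrite -(@eqrXn2 _ 2) //.
by rewrite expr1n -norm_star_mul aK norm1.
Qed.

(** * Density of a *-subalgebra in the C*-algebra that it generates *)

Definition star_subalgebra D :=
  [/\ D 1,
      (forall (k : R[i]) a b, D a -> D b -> D (k *: a + b)),
      (forall a b, D a -> D b -> D (a * b))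
    & (forall a, D a -> D (star a))].

Lemma closure_normP D a :
  closure D a <-> forall e : R[i], 0 < e -> exists2 b, D b & `|a - b| < e.
Proof.
split=> [cDa e e0|cDa U /nbhs_ballP[e /= e0 eU]].
  have [b [Db]] := cDa _ (nbhsx_ballx a e e0).
  by rewrite -ball_normE; exists b.
have [b Db ab] := cDa e e0; exists b; split=> //; apply: eU.
by rewrite -ball_normE.
Qed.

Lemma lipschitz_closure D (E : set A) (f : A -> A) (k : R[i]) :
  0 <= k -> (forall a b, `|f a - f b| <= k * `|a - b|) ->
  (forall a, D a -> E (f a)) -> forall a, closure D a -> closure E (f a).
Proof.
move=> k0 fk fDE a /closure_normP cDa; apply/closure_normP => e e0.
have k1 : 0 < k + 1 by rewrite ltr_wpDl.
have [b Db ab] := cDa (e / (k + 1)) (divr_gt0 e0 k1).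
exists (f b); first exact: fDE.
apply: le_lt_trans (fk a b) _.
rewrite ltr_pdivlMr // in ab.
apply: le_lt_trans ab; rewrite mulrC ler_wpM2l // lerDl.
exact: ler01.
Qed.

(** Each operation is Lipschitz in one variable at a time; for the binary ones
    the two variables are moved to the closure successively. *)
Lemma closure_star_subalgebra D :
  star_subalgebra D -> cstar_subalgebra (closure D).
Proof.
move=> [D1 Dlin Dmul Dstar].
have ccl a : closure (closure D) a -> closure D a.
  by rewrite -(closure_id (closure D)).1 //; exact: closed_closure.
split.
- exact: closed_closure.
- exact: subset_closure.
- move=> k a b Da Db; apply: ccl.
  apply: (@lipschitz_closure D _ (fun x => k *: x + b) `|k|) => //= [x y|x Dx].
    by rewrite opprD addrACA subrr addr0 -scalerBr normrZ.
  apply: (@lipschitz_closure D _ (fun y => k *: x + y) 1) => //= [y z|y Dy].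
    by rewrite opprD addrACA subrr add0r mul1r.
  exact: Dlin.
- move=> a b Da Db; apply: ccl.
  apply: (@lipschitz_closure D _ (fun x => x * b) `|b|) => //= [x y|x Dx].
    by rewrite -mulrBl mulrC norm_mul_le.
  apply: (@lipschitz_closure D _ (fun y => x * y) `|x|) => //= [y z|y Dy].
    by rewrite -mulrBr norm_mul_le.
  exact: Dmul.
- apply: (@lipschitz_closure D _ star 1) => // x y.
  by rewrite -star_sub norm_star mul1r.
Qed.

Lemma cstar_gen_closure (G : set A) D :
  star_subalgebra D -> G `<=` D -> cstar_gen G `<=` closure D.
Proof.
move=> sD GD; apply: smallest_sub; first exact: closure_star_subalgebra.
by apply: subset_trans GD _; exact: subset_closure.
Qed.

End CStarTheory.

(** * Compressions by powers of the Cuntz isometries *)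

Section Cuntz.
Context {R : realType} {A : cstarAlgType R} (S1 S2 : A).
Hypotheses (isoS1 : isometry_elt S1) (isoS2 : isometry_elt S2)
  (cuntz : S1 * star S1 + S2 * star S2 = 1).
Implicit Types (a b w : A) (m n : nat).

(** Compressing the Cuntz relation by S1 leaves star x * x = 0 for
    x = star S2 * S1. *)
Lemma cuntz_orthogonal : star S2 * S1 = 0.
Proof.
apply: star_mul_eq0; rewrite star_mul starK.
have := congr1 (fun x => star S1 * x * S1) cuntz.
rewrite /= mulr1 mulrDr mulrDl !mulrA isoS1 mul1r isoS1 => /eqP.
by rewrite -subr_eq0 addrAC subrr add0r => /eqP.
Qed.

Lemma cuntz_orthogonal_sym : star S1 * S2 = 0.
Proof.
by rewrite -[S2]starK -star_mul cuntz_orthogonal star0.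
Qed.

(** The non-self-adjoint algebra of polynomials in S1 and S2; generating it by
    multiplications on the left only lets star S1 and star S2 cancel the last
    letter put on a word. *)
Inductive analytic : A -> Prop :=
| analytic1 : analytic 1
| analytic_lin (k : R[i]) a b :
    analytic a -> analytic b -> analytic (k *: a + b)
| analytic_S1 a : analytic a -> analytic (S1 * a)
| analytic_S2 a : analytic a -> analytic (S2 * a).

Lemma analytic0 : analytic 0.
Proof.
rewrite -(_ : -1 *: 1 + 1 = 0); first exact: analytic_lin analytic1 analytic1.
by rewrite scaleN1r addNr.
Qed.

Lemma analytic_mulXr w n : analytic w -> analytic (w * S1 ^+ n).
Proof.
elim=> [|k a b _ IHa _ IHb|a _ IHa|a _ IHa].
- rewrite mul1r; elim: n => [|n IHn]; first exact: analytic1.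
  by rewrite exprS; exact: analytic_S1.
- by rewrite mulrDl -scalerAl; exact: analytic_lin.
- by rewrite -mulrA; exact: analytic_S1.
- by rewrite -mulrA; exact: analytic_S2.
Qed.

(** The elements whose left multiplication keeps the analytic elements
    analytic, up to a power of S1 on the right.  Quantifying over all w, and
    not only over w = 1, is what makes this set stable under products. *)
Definition absorbed a :=
  forall w, analytic w -> exists n, analytic (a * w * S1 ^+ n).

Lemma absorbed_lin (k : R[i]) a b :
  absorbed a -> absorbed b -> absorbed (k *: a + b).
Proof.
move=> ha hb w aw; have [n an] := ha w aw; have [m bm] := hb w aw.
exists (n + m)%N; rewrite !mulrDl -!scalerAl; apply: analytic_lin.
  by rewrite exprD mulrA; exact: analytic_mulXr.
by rewrite addnC exprD mulrA; exact: analytic_mulXr.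
Qed.

Lemma absorbed_mul a b : absorbed a -> absorbed b -> absorbed (a * b).
Proof.
move=> ha hb w aw; have [n bn] := hb w aw; have [m an] := ha _ bn.
by exists (n + m)%N; move: an; rewrite exprD !mulrA.
Qed.

Lemma absorbed1 : absorbed 1.
Proof. by move=> w aw; exists 0; rewrite mul1r mulr1. Qed.

(** An adjoint T either cancels the first letter of a word, or kills the word,
    or meets the empty word; in the last case one factor S1 on the right
    settles the matter. *)
Lemma absorbed_adjoint T :
  analytic (T * S1) -> (forall w, analytic w -> analytic (T * (S1 * w))) ->
  (forall w, analytic w -> analytic (T * (S2 * w))) -> absorbed T.
Proof.
move=> T1 TS1 TS2 w; elim=> [|k a b _ [n an] _ [m bm]|a aa _|a aa _].
- by exists 1; rewrite mulr1 expr1.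
- exists (n + m)%N; rewrite mulrDr mulrDl -scalerAr -scalerAl.
  apply: analytic_lin.
    by rewrite exprD mulrA; exact: analytic_mulXr.
  by rewrite addnC exprD mulrA; exact: analytic_mulXr.
- by exists 0; rewrite mulr1; exact: TS1.
- by exists 0; rewrite mulr1; exact: TS2.
Qed.

Lemma absorbed_starS1 : absorbed (star S1).
Proof.
apply: absorbed_adjoint => [|w aw|w aw]; first by rewrite isoS1; exact: analytic1.
  by rewrite mulrA isoS1 mul1r.
by rewrite mulrA cuntz_orthogonal_sym mul0r; exact: analytic0.
Qed.

Lemma absorbed_starS2 : absorbed (star S2).
Proof.
apply: absorbed_adjoint => [|w aw|w aw].
- by rewrite cuntz_orthogonal; exact: analytic0.
- by rewrite mulrA cuntz_orthogonal mul0r; exact: analytic0.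
- by rewrite mulrA isoS2 mul1r.
Qed.

(** A *-subalgebra containing the *-polynomials in S1 and S2: membership is
    symmetrized because absorption by powers of S1 on the right is not
    preserved by the involution. *)
Definition starpoly : set A := [set a | absorbed a /\ absorbed (star a)].

Lemma star_subalgebra_starpoly : star_subalgebra starpoly.
Proof.
split.
- by split; rewrite ?star1; exact: absorbed1.
- move=> k a b [ha hsa] [hb hsb]; split; first exact: absorbed_lin.
  by rewrite starD starZ; exact: absorbed_lin.
- move=> a b [ha hsa] [hb hsb]; split; first exact: absorbed_mul.
  by rewrite star_mul; exact: absorbed_mul.
- by move=> a [ha hsa]; split; rewrite ?starK.
Qed.

Lemma starpoly_generators : [set S1; S2] `<=` starpoly.
Proof.
move=> _ [->|->]; split; [|exact: absorbed_starS1| |exact: absorbed_starS2];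
  move=> w aw; exists 0; rewrite mulr1; [exact: analytic_S1|exact: analytic_S2].
Qed.

Definition compression n a := star S2 ^+ n * a * S1 ^+ n.

Lemma compressionD m n a :
  compression (m + n) a = compression m (compression n a).
Proof. by rewrite /compression exprD addnC exprD !mulrA. Qed.

Lemma compression0 n : compression n 0 = 0.
Proof. by rewrite /compression mulr0 mul0r. Qed.

Lemma compression_linear n (k : R[i]) a b :
  compression n (k *: a + b) = k *: compression n a + compression n b.
Proof. by rewrite /compression mulrDr mulrDl -scalerAr -scalerAl. Qed.

Lemma compression_sub n a b :
  compression n (a - b) = compression n a - compression n b.
Proof. by rewrite /compression mulrBr mulrBl. Qed.

Lemma norm_compression_le n a : `|compression n a| <= `|a|.
Proof.
elim: n => [|n IHn]; first by rewrite /compression mul1r mulr1.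
apply: le_trans IHn; rewrite -add1n compressionD.
apply: le_trans (norm_mul_le _ _) _; rewrite !expr1 (norm_isometry isoS1) mulr1.
apply: le_trans (norm_mul_le _ _) _.
by rewrite norm_star (norm_isometry isoS2) mul1r.
Qed.

(** The powers of star S2 consume a word letter by letter as long as its letters
    are S2; either they hit a letter S1, or they use up the word and meet the
    power of S1 on the right.  Both kill the word. *)
Lemma analytic_vanish w : analytic w -> exists n, compression n w = 0.
Proof.
elim=> [|k a b _ [n an] _ [m bm]|a _ _|a _ [n an]].
- by exists 1; rewrite /compression mulr1 !expr1 cuntz_orthogonal.
- exists (m + n)%N; rewrite compression_linear compressionD an compression0.
  by rewrite addnC compressionD bm compression0 scaler0 addr0.
- by exists 1; rewrite /compression !expr1 mulrA cuntz_orthogonal !mul0r.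
- exists n.+1; rewrite /compression exprSr exprSr !mulrA.
  by rewrite -(mulrA _ (star S2)) isoS2 mulr1 [_ * S1 ^+ n]an mul0r.
Qed.

Lemma starpoly_vanish a : starpoly a -> exists n, compression n a = 0.
Proof.
move=> [/(_ 1 analytic1)[n]]; rewrite mulr1 => /analytic_vanish[m hm] _.
exists (n + m)%N; rewrite -(mulr0 (star S2 ^+ n)) -hm /compression.
by rewrite [S1 ^+ (n + m)]exprD [star S2 ^+ (n + m)]exprD !mulrA.
Qed.

(** The elements that some compression kills are dense in C*(S1, S2), so a
    common fixed point of all the contractive compressions is 0. *)
Lemma compression_fixed_eq0 u :
  cstar_gen [set S1; S2] u -> (forall n, compression n u = u) -> u = 0.
Proof.
move=> /(cstar_gen_closure star_subalgebra_starpoly starpoly_generators).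
move=> /closure_normP clu fixu; apply/eqP/negPn/negP => u0.
have [|a /starpoly_vanish[n an]] := clu `|u|; first by rewrite normr_gt0.
have := norm_compression_le n (u - a).
rewrite compression_sub an subr0 fixu => ua.
by move=> /(le_lt_trans ua); rewrite ltxx.
Qed.

(** star S2 * (u * S1) = star S2 * (S2 * u) = u. *)
Lemma intertwiner_fixed u n : u * S1 = S2 * u -> compression n u = u.
Proof.
move=> uS; elim: n => [|n IHn]; first by rewrite /compression mul1r mulr1.
rewrite -addn1 compressionD -[RHS]IHn; congr compression.
by rewrite /compression !expr1 -mulrA uS mulrA isoS2 mul1r.
Qed.

End Cuntz.

Theorem proposition2p2 (R : realType) (B : cstarAlgType R) (S1 S2 : B)
    (isoS1 : isometry_elt S1) (isoS2 : isometry_elt S2)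
    (cuntz : S1 * star S1 + S2 * star S2 = 1)
    (sigma : B -> B)
    (sigma_aut : star_automorphism (cstar_gen [set S1; S2]) sigma)
    (sigma_order2 : order_two_on (cstar_gen [set S1; S2]) sigma)
    (sigmaS1 : sigma S1 = S2) :
  ~ inner_on (cstar_gen [set S1; S2]) sigma.
Proof.
move=> [u [Du [uK _] sigmaE]].
have genS1 : cstar_gen [set S1; S2] S1 by apply: sub_gen_smallest; left.
have uS : u * S1 = S2 * u.
  by rewrite -sigmaS1 sigmaE // -mulrA uK mulr1.
have u0 : u = 0.
  apply: (compression_fixed_eq0 isoS1 isoS2 cuntz Du) => n.
  exact: intertwiner_fixed.
by move: uK; rewrite u0 mulr0 => /eqP; rewrite eq_sym oner_eq0.
Qed.
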